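(* Let $(c_n)_{n\in\mathbb{N}}$ be a sequence of real numbers with $0<c_n<1$ for every $n\in\mathbb{N}$. For each $n\in\mathbb{N}$ let $f_n:\mathbb{R}\to\mathbb{R}$ be a continuous function such that $0<f_n(x)<1$ for all $x\in\mathbb{R}$, $\int_{-\infty}^{+\infty}f_n(x)\,dx=1$, and $f_n(x)=c_n$ for all $x\in[0,1]$. Let $\mu_n$ be the Borel probability measure on $\mathbb{R}$ with density $f_n$ with respect to Lebesgue measure. If $\prod_{n\in\mathbb{N}}c_n>0$, then the measures $\prod_{n\in\mathbb{N}}\mu_n$ and $\nu_{[0,1]^{\mathbb{N}}}$ on the Borel $\sigma$-algebra of $\mathbb{R}^{\mathbb{N}}$ are equivalent.
   Context: Here $\mathbb{N}=\{1,2,\dots\}$, and $\mathbb{R}^{\mathbb{N}}$ is the space of all real sequences with the product (Tychonoff) topology, with Borel $\sigma$-algebra $B(\mathbb{R}^{\mathbb{N}})$. Two $\sigma$-finite measures $\mu,\nu$ on a measurable space $(X,M)$ are called equivalent if for every $E\in M$ one has $\mu(E)=0$ if and only if $\nu(E)=0$. The measure $\nu_{[0,1]^{\mathbb{N}}}$ is defined as follows. For $n\in\mathbb{N}$ put $A_n=\mathbb{R}^n\times\prod_{i>n}[0,1]\subseteq\mathbb{R}^{\mathbb{N}}$. Let $m$ denote Lebesgue measure on $\mathbb{R}$ and let $\lambda$ denote Lebesgue measure on $[0,1]$ (so $\lambda([0,1])=1$). Let $\nu_n$ be the product measure $m^{n}\times\prod_{i>n}\lambda$ on $A_n$ (the first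 $n$ factors are $m$, all the remaining ones are $\lambda$), and for $X\in B(\mathbb{R}^{\mathbb{N}})$ put $\overline{\nu}_n(X)=\nu_n(X\cap A_n)$. For every $X\in B(\mathbb{R}^{\mathbb{N}})$ the limit $$\nu_{[0,1]^{\mathbb{N}}}(X)=\lim_{n\to\infty}\overline{\nu}_n(X)\in[0,+\infty]$$ exists, and it defines a nontrivial $\sigma$-finite Borel measure on $\mathbb{R}^{\mathbb{N}}$. *)

(* Defs.v *)
From HB Require Import structures.
From mathcomp Require Import all_boot all_order all_algebra.
From mathcomp Require Import all_classical all_reals all_analysis.

Set Implicit Arguments.
Unset Strict Implicit.
Unset Printing Implicit Defensive.

Import Order.TTheory GRing.Theory Num.Theory.
Import numFieldNormedType.Exports.

Local Open Scope classical_set_scope.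
Local Open Scope ring_scope.

(* The positive integers indexing coordinates are shifted to nat: the k-th
   coordinate of a sequence x is [x k.-1]. *)
Definition seqspace (R : realType) :=
  g_sigma_algebraType (@open {ptws nat -> R}).

(* [is_product_measure N m P]: P is the product of the Borel measures m i, all
   of which are probability measures from index N on.  The value of P is only
   prescribed on boxes constraining the first k >= N coordinates, since a box
   leaving a coordinate i < N free has an extra factor [m i setT].  These boxes
   form a pi-system generating the Borel sigma-algebra, so P is unique when the
   m i are sigma-finite.  In \bar R, [0 * +oo = 0]. *)
Definition is_product_measure (R : realType) (N : nat)
    (m : nat -> {measure set (measurableTypeR R) -> \bar R})
    (P : {measure set (seqspace R) -> \bar R}) : Prop :=
  forall (k : nat) (B : nat -> set (measurableTypeR R)), (N <= k)%N ->
    (forall i, measurable (B i)) ->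
    P [set x : seqspace R | forall i, (i < k)%N -> B i (x i)] =
      (\prod_(i < k) m i (B i))%E.

Definition lebesgue01 (R : realType) :
    {measure set (measurableTypeR R) -> \bar R} :=
  mrestr lebesgue_measure (measurable_itv (`[0, 1] : interval R)).

Definition cube_factor (R : realType) (n i : nat) :
    {measure set (measurableTypeR R) -> \bar R} :=
  if (i < n)%N then (lebesgue_measure : {measure set _ -> \bar R})
  else lebesgue01 R.

Definition cube_strip (R : realType) (n : nat) : set (seqspace R) :=
  [set x | forall i, (n <= i)%N -> 0 <= (x i : R) <= 1].

(* The measures [nu_ n] live on the whole sequence space, but are carried by
   [cube_strip n]. *)
Definition is_nu_cube (R : realType)
    (nu : {measure set (seqspace R) -> \bar R}) : Prop :=
  exists nu_ : nat -> {measure set (seqspace R) -> \bar R},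
    (forall n, is_product_measure n (cube_factor R n) (nu_ n)) /\
    (forall X : set (seqspace R), measurable X ->
       nu_ n (X `&` cube_strip n) @[n --> \oo] --> nu X).

Definition equivalent_measures d (T : measurableType d) (R : realType)
    (mu nu : {measure set T -> \bar R}) : Prop :=
  forall E : set T, measurable E -> (mu E = 0%E <-> nu E = 0%E).

(* Main.v *)
Require Import Defs.
From HB Require Import structures.
From mathcomp Require Import all_boot all_order all_algebra.
From mathcomp Require Import all_classical all_reals all_analysis.
From mathcomp Require Import measurable_realfun.

Import Order.TTheory GRing.Theory Num.Theory.
Import numFieldNormedType.Exports.

Local Open Scope classical_set_scope.
Local Open Scope ring_scope.

(** Write P for the product of the mu i, nu_ n for the product of n Lebesgue
    measures and of Lebesgue measures on [0, 1], S n for the strip where all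
    coordinates of index at least n lie in [0, 1], and a n for the infinite
    product of the c i with i >= n.

    On the strip S n, the density of P with respect to nu_ n is
    a n * f 0 (x 0) * ... * f n.-1 (x n.-1), because f i is the constant c i on
    [0, 1].  To make sense of this, let Q n be nu_ n weighted by the first n
    densities, one coordinate at a time ([product_measure_densities]).  It is
    the product of mu 0, ..., mu n.-1 and Lebesgue measures on [0, 1].  As
    every f i takes its values in ]0, 1[, Q n <= nu_ n, and both have the same
    null sets.  Comparing two finite measures on cylinders gives
    P (E `&` S n) = a n * Q n E ([product_measure_cube_strip]).

    Positivity of the infinite product enters twice.  It gives a n > 0, so
    that P-null sets inside S n are Q n-null, hence nu_ n-null; the limit
    defining nu then vanishes.  It also gives a n --> 1, so that P (S n) --> 1
    and P E = lim P (E `&` S n) ([cvg_measure_setI_exhaustion]).  Since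
    P (E `&` S n) <= Q n (E `&` S n) <= nu_ n (E `&` S n), passing to the limit
    yields P <= nu, and nu-null sets are P-null. *)

(** * Cylinders generate the Borel sigma-algebra of the sequence space *)

Definition cylinder {R : realType} (k : nat)
    (B : nat -> set (measurableTypeR R)) : set (seqspace R) :=
  [set x | forall i, (i < k)%N -> B i (x i)].

(** The lower bound N on the number of constrained coordinates matches
    [is_product_measure], which prescribes the measure of these cylinders
    only. *)
Definition cylinders (R : realType) (N : nat) : set (set (seqspace R)) :=
  [set A | exists k B, [/\ (N <= k)%N, forall i, measurable (B i) &
                           A = cylinder k B]].

Definition rational_box (R : realType) (s : seq (rat * rat)) :
    set (seqspace R) :=
  cylinder (size s)
    (fun i => `]ratr (nth (0, 0) s i).1, ratr (nth (0, 0) s i).2[%classic).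

(** The sets on the right are a filter base converging to x in every
    coordinate, hence in the product topology, so the filter contains U. *)
Lemma ptws_open_box {R : realType} (U : set {ptws nat -> R})
    (x : {ptws nat -> R}) : open U -> U x ->
  exists k e, 0 < e /\
    [set y : nat -> R | forall i, (i < k)%N -> `|x i - y i| < e] `<=` U.
Proof.
move=> oU Ux.
pose b (p : nat * R) :=
  [set y : nat -> R | forall i, (i < p.1)%N -> `|x i - y i| < p.2].
pose F := filter_from [set p : nat * R | 0 < p.2] b.
have FF : Filter F.
  apply: filter_from_filter; first by exists (0%N, 1) => /=.
  move=> [k e] [l r]/= e0 r0; exists (maxn k l, Num.min e r).
    by rewrite /= lt_min e0.
  move=> y /= ybd; split => i /= ik.
    by have := ybd i; rewrite leq_max ik lt_min => /(_ erefl)/andP[].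
  by have := ybd i; rewrite leq_max ik orbT lt_min => /(_ erefl)/andP[].
have : F --> x.
  apply/cvg_sup => i A /= [_ [[B oB <-] Bxi sBA]].
  have [e /= e0 eB] : nbhs (x i) B by exact: open_nbhs_nbhs.
  exists (i.+1, e) => //= y /= ybd; apply: sBA; apply: eB => /=.
  exact: ybd.
move=> /(_ U)[|[k e] /= e0 keU]; first exact: open_nbhs_nbhs.
by exists k, e.
Qed.

Lemma open_rational_box {R : realType} (U : set {ptws nat -> R})
    (x : {ptws nat -> R}) : open U -> U x ->
  exists s, rational_box R s x /\ rational_box R s `<=` U.
Proof.
move=> oU Ux; have [k [e [e0 keU]]] := ptws_open_box _ _ oU Ux.
have /choice[q qP] i : exists q : rat * rat,
    [/\ x i - e < ratr q.1, ratr q.1 < x i, x i < ratr q.2 &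
        ratr q.2 < x i + e].
  have [q1] : exists q : rat, ratr q \in `](x i - e), (x i)[.
    by apply: rat_in_itvoo; rewrite ltrBlDr ltrDl.
  have [q2] : exists q : rat, ratr q \in `](x i), (x i + e)[.
    by apply: rat_in_itvoo; rewrite ltrDl.
  by rewrite !in_itv/= => /andP[? ?] /andP[? ?]; exists (q1, q2).
exists (mkseq q k); split.
  move=> i /=; rewrite size_mkseq => ik; rewrite /= in_itv/= nth_mkseq//.
  by have [_ -> -> _] := qP i.
move=> y /= yb; apply: keU => i /= ik.
move: (yb i); rewrite size_mkseq => /(_ ik); rewrite /= in_itv/= nth_mkseq//.
move=> /andP[q1y yq2]; have [q1 _ _ q2] := qP i.
by rewrite distrC ltr_distl (lt_trans q1 q1y) (lt_trans yq2 q2).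
Qed.

Lemma measurable_coord {R : realType} i :
  measurable_fun [set: seqspace R]
    (fun x : seqspace R => x i : measurableTypeR R).
Proof.
apply: (measurability _ (RGenOpens.measurableE R)).
move=> _ [_ [a [b ->] <-]]; rewrite setTI; apply: sub_sigma_algebra.
have cp : continuous (fun x : {ptws nat -> R} => x i).
  exact: (@proj_continuous nat (fun=> R : topologicalType) i).
exact/((continuousP _).1 cp)/interval_open.
Qed.

Lemma measurable_cylinder {R : realType} k
    (B : nat -> set (measurableTypeR R)) :
  (forall i, measurable (B i)) -> measurable (cylinder k B).
Proof.
move=> mB.
have -> : cylinder k B =
    \bigcap_(i in `I_k)
      ((fun x : seqspace R => x i : measurableTypeR R) @^-1` B i).
  by [].
apply: bigcap_measurableType => i _; rewrite -[X in measurable X]setTI.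
exact: measurable_coord.
Qed.

(** Padding with unconstrained coordinates brings two cylinders to a common
    length, or the length above a given bound. *)
Lemma cylinder_widen {R : realType} k n (B : nat -> set (measurableTypeR R)) :
  cylinder k B =
  cylinder (maxn n k) (fun i => if (i < k)%N then B i else setT).
Proof.
apply/seteqP; split => x /= xB i.
  by case: ifP => // ik _; exact: xB.
by move=> ik; have := xB i; rewrite leq_max ik orbT; apply.
Qed.

Lemma setI_closed_cylinders {R : realType} N : setI_closed (cylinders R N).
Proof.
move=> _ _ [k [B [Nk mB ->]]] [l [C [Nl mC ->]]].
exists (maxn k l), (fun i => (if (i < k)%N then B i else setT) `&`
                             (if (i < l)%N then C i else setT)); split.
- by rewrite leq_max Nk.
- by move=> i; apply: measurableI; case: ifP.
- rewrite (cylinder_widen k l) (cylinder_widen l k) [maxn l k]maxnC.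
  apply/seteqP; split => x /=.
    by move=> [xB xC] i ikl; split; [exact: xB|exact: xC].
  by move=> xBC; split=> i /xBC[].
Qed.

(** An open set is the union of the rational boxes that it contains, and there
    are countably many of them. *)
Lemma measurable_seqspaceE {R : realType} N :
  @measurable _ (seqspace R) = <<s cylinders R N >>.
Proof.
apply/seteqP; split; last first.
  apply: smallest_sub; first exact: sigma_algebra_measurable.
  by move=> _ [k [B [_ mB ->]]]; exact: measurable_cylinder.
apply: smallest_sub; first exact: smallest_sigma_algebra.
move=> U oU.
have -> : U = \bigcup_(s in [set s | rational_box R s `<=` U]) rational_box R s.
  apply/seteqP; split => [x Ux|x [s sU]]; last exact: sU.
  by have [s [sx sU]] := open_rational_box _ _ oU Ux; exists s.
rewrite bigcup_mkcond.
apply: (@countable_bigcupT_measurable _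
  (g_sigma_algebraType (cylinders R N))) => // s.
case: ifP => // _; apply: sub_sigma_algebra.
rewrite /rational_box (cylinder_widen _ N).
exists (maxn N (size s)); eexists; split; [exact: leq_maxl| |reflexivity].
by move=> i /=; case: ifP.
Qed.

Lemma eq_finite_measure_cylinders {R : realType} N
    (P Q : {measure set (seqspace R) -> \bar R}) :
  (P setT < +oo)%E ->
  (forall k (B : nat -> set (measurableTypeR R)), (N <= k)%N ->
    (forall i, measurable (B i)) -> P (cylinder k B) = Q (cylinder k B)) ->
  forall E, measurable E -> P E = Q E.
Proof.
move=> Poo PQ E mE.
apply: (measure_unique (cylinders R N) (fun=> setT)) => //.
- exact: measurable_seqspaceE.
- exact: setI_closed_cylinders.
- move=> _; exists N, (fun=> setT); split => //.
  by apply/seteqP; split.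
- by rewrite bigcup_const.
- by move=> _ [k [B [Nk mB ->]]]; exact: PQ.
Qed.

(** * Weighting a product measure by a density in one coordinate *)

Lemma exists_density_measure {d} {T : measurableType d} {R : realType}
    (mu : {measure set T -> \bar R}) (g : T -> \bar R) :
  measurable_fun [set: T] g -> (forall x, (0 <= g x)%E) ->
  exists nu : {measure set T -> \bar R},
    forall A, nu A = (\int[mu]_(x in A) g x)%E.
Proof.
move=> mg g0; pose nu A := (\int[mu]_(x in A) g x)%E.
have nu0 : nu set0 = 0%E by rewrite /nu integral_set0.
have nu_ge0 A : (0 <= nu A)%E by apply: integral_ge0 => x _.
have nu_add : semi_sigma_additive nu.
  exact: semi_sigma_additive_nng_induced.
pose nu_mixin := isMeasure.Build d T R nu nu0 nu_ge0 nu_add.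
by exists (HB.pack nu nu_mixin : {measure set T -> \bar R}).
Qed.

(** A positive weight does not create null sets. *)
Lemma integral_gt0_null {d} {T : measurableType d} {R : realType}
    (mu : {measure set T -> \bar R}) (g : T -> \bar R) (E : set T) :
  measurable E -> measurable_fun E g -> (forall x, (0 < g x)%E) ->
  (\int[mu]_(x in E) g x)%E = 0%E -> mu E = 0%E.
Proof.
move=> mE mg g0 g_int.
have : (\int[mu]_(x in E) `|g x|)%E = 0%E.
  by rewrite -[RHS]g_int; apply: eq_integral => x _; rewrite gee0_abs// ltW.
move=> /(ae_eq_integral_abs mu mE mg) [A [mA A0 EA]].
apply: (subset_measure0 mE mA _ A0) => x Ex; apply: EA => /= /(_ Ex) gx0.
by have := g0 x; rewrite gx0 ltxx.
Qed.

(** With the convention +oo * 0 = 0. *)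
Lemma nneseries_cst {R : realType} (b : \bar R) :
  (0 <= b)%E -> (\sum_(n <oo) b = +oo * b)%E.
Proof.
case: b => [r| _|//].
  rewrite lee_fin le_eqVlt => /predU1P[<-|r0].
    by rewrite eseries0 ?mule0.
  rewrite mulyr gtr0_sg// mul1e; apply: eq_infty => M.
  pose n := (Num.truncn (M / r)).+1.
  apply: (@le_trans _ _ (\sum_(0 <= k < n) r%:E)%E); last first.
    by apply: nneseries_lim_ge => k _ _; rewrite lee_fin ltW.
  rewrite sumEFin big_const_nat subn0 iter_addr_0 lee_fin -mulr_natl.
  by rewrite -ler_pdivrMr// ltW// truncnS_gt.
by rewrite (nneseries_pinfty (k := 0%N))// muleyy.
Qed.

(** The factor a may be +oo: rho is then the sum of countably many copies of
    m.  This occurs when the other sides of a box have infinite Lebesgue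
    measure. *)
Lemma ge0_integral_proportional {d} {T : measurableType d} {R : realType}
    (m rho : {measure set T -> \bar R}) (a : \bar R) (h : T -> \bar R)
    (B : set T) :
  (0 <= a)%E -> (forall A, measurable A -> rho A = a * m A)%E ->
  measurable B -> measurable_fun B h -> (forall x, (0 <= h x)%E) ->
  (\int[rho]_(x in B) h x = a * \int[m]_(x in B) h x)%E.
Proof.
case: a => [r r0 rhoE mB mh h0|_ rhoE mB mh h0|//].
  rewrite (eq_measure_integral (mscale (NngNum r0) m)).
    exact: ge0_integral_mscale.
  by move=> A mA _; exact: rhoE.
rewrite (eq_measure_integral (mseries (fun=> m) 0)).
  rewrite ge0_integral_measure_series//=; apply: nneseries_cst.
  exact: integral_ge0.
by move=> A mA _; rewrite rhoE//; exact/esym/nneseries_cst.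
Qed.

Lemma ge0_integral_mrestr {d} {T : measurableType d} {R : realType}
    (mu : {measure set T -> \bar R}) (h : T -> \bar R) (D E : set T)
    (mD : measurable D) :
  measurable E -> measurable_fun [set: T] h -> (forall x, (0 <= h x)%E) ->
  (\int[mrestr mu mD]_(x in E) h x = \int[mu]_(x in E `&` D) h x)%E.
Proof.
move=> mE mh h0.
rewrite [LHS](@ge0_negligible_integral _ _ _ _ E (E `\` D))//.
- rewrite setDD; apply: eq_measure_integral => A mA AED.
  by rewrite /= /mrestr setIidl// => x /AED[].
- exact: measurableD.
- exact: measurable_funTS.
- by rewrite /= /mrestr setDE -setIA setICl setI0 measure0.
Qed.

(** Q has density h (x j) with respect to P.  On a box, freeze all sides but
    the j-th: the measure of the box is then a measure in the j-th side,
    proportional to m j.  The integral of h (x j) over the box is thus, up to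
    that factor, an integral against m j on the line. *)
Lemma product_measure_density {R : realType} (N : nat)
    (m : nat -> {measure set (measurableTypeR R) -> \bar R})
    (P : {measure set (seqspace R) -> \bar R}) (j : nat) (h : R -> R)
    (mj : {measure set (measurableTypeR R) -> \bar R}) :
  is_product_measure N m P -> (j < N)%N ->
  measurable_fun [set: measurableTypeR R] h -> (forall x, 0 < h x < 1) ->
  (forall A : set (measurableTypeR R), measurable A ->
    mj A = (\int[m j]_(x in A) (h x)%:E)%E) ->
  exists Q : {measure set (seqspace R) -> \bar R},
    [/\ is_product_measure N (fun i => if i == j then mj else m i) Q,
        forall E, measurable E -> (Q E <= P E)%E &
        forall E, measurable E -> Q E = 0%E -> P E = 0%E].
Proof.
move=> Pm jN mh h01 mjE.
pose X (x : seqspace R) : measurableTypeR R := x j.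
have mX : measurable_fun [set: seqspace R] X by exact: measurable_coord.
pose g (x : seqspace R) : \bar R := (h (X x))%:E.
have mg : measurable_fun [set: seqspace R] g.
  apply/measurable_EFinP; exact: (measurableT_comp mh mX).
have g0 x : (0 < g x)%E by rewrite lte_fin; have /andP[] := h01 (X x).
have [Q QE] := exists_density_measure P g mg (fun x => ltW (g0 x)).
exists Q; split; last 2 first.
- move=> E mE; rewrite QE -[leRHS]mul1e -integral_cst//.
  apply: ge0_le_integral => //.
  + by move=> x _; exact: ltW.
  + exact: measurable_funTS.
  + by move=> x _; rewrite lee_fin; have /andP[_ /ltW] := h01 (X x).
- move=> E mE; rewrite QE => /integral_gt0_null; apply => //.
  exact: measurable_funTS.
move=> k B Nk mB; rewrite QE.
have jk : (j < k)%N := leq_trans jN Nk.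
(* the box B with its j-th side replaced by A *)
pose C A i := if i == j then A else B i.
have mC A : measurable A -> forall i, measurable (C A i).
  by move=> mA i; rewrite /C; case: ifP.
have CE A : cylinder k (C A) = X @^-1` A `&` cylinder k (C setT).
  apply/seteqP; split => x /=.
    move=> xC; split; first by have := xC j jk; rewrite /C eqxx.
    by move=> i ik; have := xC i ik; rewrite /C; case: ifP.
  move=> [xA xC] i ik; have := xC i ik; rewrite /C; case: ifPn => // /eqP ->.
  by [].
have -> : [set x : seqspace R | forall i, (i < k)%N -> B i (x i)] =
    X @^-1` B j `&` cylinder k (C setT).
  rewrite -CE; congr cylinder; apply/funext => i; rewrite /C.
  by case: eqP => // ->.
have mD : measurable (cylinder k (C setT)) by apply: measurable_cylinder; exact: mC.
have mXB : measurable (X @^-1` B j) by rewrite -[X in measurable X]setTI; exact: mX.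
rewrite -(ge0_integral_mrestr _ _ _ _ mD)//; last first.
  by move=> x; exact: ltW.
pose hE (y : measurableTypeR R) := (h y)%:E.
have mhE : measurable_fun [set: measurableTypeR R] hE by exact/measurable_EFinP.
have hE0 y : (0 <= hE y)%E by rewrite lee_fin; have /andP[/ltW] := h01 y.
transitivity (\int[pushforward (mrestr P mD) X]_(y in B j) hE y)%E.
  by rewrite ge0_integral_pushforward//; exact: measurable_funTS.
(* proportionality factor: the product of the other sides, possibly +oo *)
pose a := (\prod_(i < k | i != Ordinal jk) m i (B i))%E.
rewrite (ge0_integral_proportional (m j) _ a)//; last 3 first.
- by apply: prode_ge0 => i _.
- move=> A mA; transitivity (P (cylinder k (C A))); first by rewrite [in RHS]CE.
  rewrite Pm//; last exact: mC.
  rewrite (bigD1 (Ordinal jk))//= /C eqxx muleC; congr (_ * _)%E.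
  by apply: eq_bigr => i; rewrite -val_eqE/= => /negbTE ->.
- exact: measurable_funTS.
rewrite -mjE// (bigD1 (Ordinal jk))//= eqxx muleC; congr (_ * _)%E.
by apply: eq_bigr => i; rewrite -val_eqE/= => /negbTE ->.
Qed.

(** Iteration of [product_measure_density] over the first n coordinates. *)
Lemma product_measure_densities {R : realType} (n : nat)
    (m mu : nat -> {measure set (measurableTypeR R) -> \bar R})
    (P : {measure set (seqspace R) -> \bar R}) (f : nat -> R -> R) :
  is_product_measure n m P ->
  (forall i, measurable_fun [set: measurableTypeR R] (f i)) ->
  (forall i x, 0 < f i x < 1) ->
  (forall i (A : set (measurableTypeR R)), (i < n)%N -> measurable A ->
    mu i A = (\int[m i]_(x in A) (f i x)%:E)%E) ->
  exists Q : {measure set (seqspace R) -> \bar R},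
    [/\ is_product_measure n (fun i => if (i < n)%N then mu i else m i) Q,
        forall E, measurable E -> (Q E <= P E)%E &
        forall E, measurable E -> Q E = 0%E -> P E = 0%E].
Proof.
move=> Pm mf f01 muE.
suff : forall k, (k <= n)%N -> exists Q : {measure set (seqspace R) -> \bar R},
    [/\ is_product_measure n (fun i => if (i < k)%N then mu i else m i) Q,
        forall E, measurable E -> (Q E <= P E)%E &
        forall E, measurable E -> Q E = 0%E -> P E = 0%E] by exact.
elim=> [_|k IHk kn]; first by exists P.
have [Q [Qm QP Q0]] := IHk (ltnW kn).
have [|Q' [Q'm Q'Q Q'0]] :=
  product_measure_density _ _ _ _ _ (mu k) Qm kn (mf k) (f01 k).
  by move=> A mA; rewrite ltnn muE.
exists Q'; split.
- rewrite (_ : (fun i => _) =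
      fun i => if i == k then mu k else if (i < k)%N then mu i else m i)//.
  by apply/funext => i; rewrite ltnS leq_eqVlt; case: eqP => [->|].
- by move=> E mE; exact: le_trans (Q'Q _ mE) (QP _ mE).
- by move=> E mE /(Q'0 _ mE)/(Q0 _ mE).
Qed.

(** * The product of probabilities on a strip *)

Lemma cube_strip_bigcap {R : realType} n :
  cube_strip (R:=R) n = \bigcap_l cylinder l
    (fun i => if (n <= i)%N then `[0, 1]%classic else setT).
Proof.
apply/seteqP; split => x /= xS.
  by move=> l _ i _; case: ifP => //= ni; rewrite in_itv/= xS.
by move=> i ni; have /= := xS i.+1 Logic.I i (ltnSn i); rewrite ni/= in_itv.
Qed.

Lemma measurable_cube_strip {R : realType} n : measurable (cube_strip (R:=R) n).
Proof.
rewrite cube_strip_bigcap; apply: bigcapT_measurable => l.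
by apply: measurable_cylinder => i; case: ifP.
Qed.

Lemma product_measure_setT {R : realType} N
    (m : nat -> {measure set (measurableTypeR R) -> \bar R})
    (P : {measure set (seqspace R) -> \bar R}) :
  is_product_measure N m P -> (forall i, (i < N)%N -> m i setT = 1%E) ->
  P setT = 1%E.
Proof.
move=> Pm m1; have := Pm N (fun=> setT) (leqnn N) (fun=> measurableT).
rewrite big1; first by move=> <-; congr (P _); apply/seteqP; split.
by move=> i _; exact: m1.
Qed.

(** Restricting mu i to [0, 1] replaces it by c i * lam i.  Doing so for all
    i >= n turns P into a multiple of Q, the factor being the infinite product
    of these c i. *)
Lemma product_measure_cube_strip {R : realType} (n : nat)
    (mu lam : nat -> {measure set (measurableTypeR R) -> \bar R})
    (P Q : {measure set (seqspace R) -> \bar R}) (c : nat -> R) (a : R) :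
  is_product_measure 0 mu P ->
  is_product_measure n (fun i => if (i < n)%N then mu i else lam i) Q ->
  (forall i, mu i setT = 1%E) ->
  (forall i (A : set (measurableTypeR R)), measurable A ->
    mu i (A `&` `[0, 1]) = ((c i)%:E * lam i A)%E) ->
  \prod_(i < l | (n <= i)%N) c i @[l --> \oo] --> a -> 0 <= a ->
  forall E, measurable E -> P (E `&` cube_strip n) = (a%:E * Q E)%E.
Proof.
move=> Pmu Qlam mu1 mulam ca a0 E mE.
have P1 : P setT = 1%E by apply: product_measure_setT Pmu _ => i.
have Q1 : Q setT = 1%E.
  by apply: product_measure_setT Qlam _ => i ->; exact: mu1.
have mS := measurable_cube_strip (R:=R) n.
apply: (eq_finite_measure_cylinders n (mrestr P mS) (mscale (NngNum a0) Q)) => //.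
  rewrite /= /mrestr setTI (@le_lt_trans _ _ 1%E) ?ltry//.
  by rewrite -P1; apply: le_measure; rewrite ?inE.
move=> k B nk mB; rewrite /= /mrestr /mscale/=.
pose U i : set (measurableTypeR R) :=
  if (n <= i)%N then `[0, 1]%classic else setT.
have mU i : measurable (U i) by rewrite /U; case: ifP.
(* constraining only the coordinates below l leaves a cylinder *)
pose F l := cylinder k B `&` cylinder l U.
have mF l : measurable (F l) by apply: measurableI; exact: measurable_cylinder.
have capF : \bigcap_l F l = cylinder k B `&` cube_strip n.
  by rewrite cube_strip_bigcap -bigcapIr//; exists 0%N.
have PF : P (F l) @[l --> \oo] --> P (cylinder k B `&` cube_strip n).
  rewrite -capF; apply: nonincreasing_cvg_mu => //.
  - rewrite (@le_lt_trans _ _ 1%E) ?ltry// -P1.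
    by apply: le_measure; rewrite ?inE.
  - exact: bigcapT_measurable.
  - move=> i j ij; apply/subsetPset => x [xB xU]; split => // l li.
    by apply: xU; exact: leq_trans ij.
have Qfin : Q (cylinder k B) \is a fin_num.
  rewrite ge0_fin_numE// (@le_lt_trans _ _ 1%E) ?ltry// -Q1.
  by apply: le_measure; rewrite ?inE//; exact: measurable_cylinder.
have PF' : P (F l) @[l --> \oo] --> (a%:E * Q (cylinder k B))%E.
  apply: (@cvg_trans _
    (((\prod_(i < l | (n <= i)%N) c i)%:E * Q (cylinder k B))%E @[l --> \oo])).
    apply: near_eq_cvg; near=> l.
    (* both sides are products over the same l coordinates *)
    have kl : (k <= l)%N by near: l; exact: nbhs_infty_ge.
    pose B' i := if (i < k)%N then B i else setT.
    have mB' i : measurable (B' i) by rewrite /B'; case: ifP.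
    have -> : cylinder k B = cylinder l B'.
      by rewrite (cylinder_widen k l) (maxn_idPl kl).
    have -> : F l = cylinder l (fun i => B' i `&` U i).
      rewrite /F (cylinder_widen k l) (maxn_idPl kl); apply/seteqP; split => x /=.
        by move=> [xB xU] i il; split; [exact: xB|exact: xU].
      by move=> xBU; split => i /xBU[].
    rewrite Pmu//; last by move=> i; exact: measurableI.
    rewrite Qlam//; last exact: leq_trans nk kl.
    rewrite big_mkcond -prodEFin -big_split; apply: eq_bigr => i _ /=.
    rewrite /U ltnNge; case: (leqP n i) => ni /=; first by rewrite mulam.
    by rewrite setIT mul1e.
  by apply: cvgeZr => //; apply/cvg_EFin; [exact: nearW|exact: ca].
by rewrite -(cvg_lim _ PF)// (cvg_lim _ PF').
Unshelve. all: by end_near. Qed.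

(** * Exhaustion by the strips *)

Lemma prod_cvgn {R : realType} (c : nat -> R) :
  (forall i, 0 < c i < 1) -> cvgn (fun l => \prod_(i < l) c i).
Proof.
move=> c01; have p0 l : 0 < \prod_(i < l) c i.
  by apply: prodr_gt0 => i _; have /andP[] := c01 i.
apply: nonincreasing_is_cvgn; last first.
  by exists 0 => _ [l _ <-]; exact: ltW.
apply/nonincreasing_seqP => l; rewrite big_ord_recr/=.
by have /andP[_ /ltW cl1] := c01 l; rewrite ler_piMr// ltW// p0.
Qed.

Lemma cvg_prod_tail {R : realType} (c : nat -> R) (n : nat) :
  (forall i, 0 < c i < 1) ->
  \prod_(i < l | (n <= i)%N) c i @[l --> \oo] -->
    limn (fun l => \prod_(i < l) c i) / \prod_(i < n) c i.
Proof.
move=> c01; apply: cvg_trans; last first.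
  exact: cvgMr_tmp (prod_cvgn _ c01).
apply: near_eq_cvg; near=> l.
have nl : (n <= l)%N by near: l; exact: nbhs_infty_ge.
rewrite [X in X / _](bigID (fun i : 'I_l => (i < n)%N))/=.
rewrite (big_ord_widen l c nl) mulrC mulKf.
  by apply: eq_bigl => i; rewrite -leqNgt.
by rewrite lt0r_neq0// prodr_gt0// => i _; have /andP[] := c01 i.
Unshelve. all: by end_near. Qed.

(** The union of the S n has full measure, by continuity from below. *)
Lemma cvg_measure_setI_exhaustion {d} {T : measurableType d} {R : realType}
    (P : {measure set T -> \bar R}) (S : nat -> set T) :
  P setT = 1%E -> (forall n, measurable (S n)) -> nondecreasing_seq S ->
  P (S n) @[n --> \oo] --> 1%E ->
  forall E, measurable E -> P (E `&` S n) @[n --> \oo] --> P E.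
Proof.
move=> P1 mS ndS PS E mE.
pose S_oo := \bigcup_n S n.
have mS_oo : measurable S_oo by exact: bigcupT_measurable.
have PS_oo : P S_oo = 1%E.
  apply: (cvg_unique _ _ PS) => //.
  exact: (nondecreasing_cvg_mu mS mS_oo ndS).
have PSC : P (~` S_oo) = 0%E.
  have : P setT = (P (setT `\` S_oo) + P (setT `&` S_oo))%E.
    exact: measureDI.
  rewrite P1 setTD setTI PS_oo => h.
  by rewrite -[LHS](@addeK _ 1%E)// -h subee.
have -> : P E = P (\bigcup_n (E `&` S n)).
  rewrite -setI_bigcupr (measureDI P mE mS_oo) [X in (X + _)%E](_ : _ = 0%E).
    by rewrite add0e.
  apply: (subset_measure0 _ _ _ PSC); last by move=> x [].
  - exact: measurableD.
  - exact: measurableC.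
apply: nondecreasing_cvg_mu.
- by move=> n; exact: measurableI.
- by apply: bigcupT_measurable => n; exact: measurableI.
- by move=> i j ij; apply/subsetPset; apply: setIS; exact/subsetPset/ndS.
Qed.

(** * Equivalence of the two measures *)

Theorem fact3p1 (R : realType) (c : nat -> R) (f : nat -> R -> R)
  (mu : nat -> probability (measurableTypeR R) R)
  (prod_mu nu_cube : {measure set (seqspace R) -> \bar R})
  (c01 : forall n, 0 < c n < 1)
  (f_continuous : forall n, continuous (f n))
  (f01 : forall n x, 0 < f n x < 1)
  (f_integral : forall n, (\int[lebesgue_measure]_x (f n x)%:E = 1)%E)
  (f_cube : forall n x, 0 <= x <= 1 -> f n x = c n)
  (mu_density : forall n (A : set (measurableTypeR R)), measurable A ->
    mu n A = (\int[lebesgue_measure]_(x in A) (f n x)%:E)%E)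
  (prod_muP : is_product_measure 0 mu prod_mu)
  (nu_cubeP : is_nu_cube nu_cube)
  (prod_c_gt0 : 0 < limn (fun n => \prod_(i < n) c i)) :
  equivalent_measures prod_mu nu_cube.
Proof.
have [nu_ [nu_P nu_lim]] := nu_cubeP.
have p_gt0 l : 0 < \prod_(i < l) c i.
  by apply: prodr_gt0 => i _; have /andP[] := c01 i.
pose a n := limn (fun l => \prod_(i < l) c i) / \prod_(i < n) c i.
have a_gt0 n : 0 < a n by rewrite divr_gt0.
have a_cvg : a n @[n --> \oo] --> (1 : R).
  rewrite -(divff (lt0r_neq0 prod_c_gt0)).
  apply: cvgMl_tmp; apply: cvgV; first by rewrite lt0r_neq0.
  exact: prod_cvgn.
pose S n : set (seqspace R) := cube_strip n.
have mS n : measurable (S n) := measurable_cube_strip n.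
pose q n i : {measure set (measurableTypeR R) -> \bar R} :=
  if (i < n)%N then (mu i : {measure set (measurableTypeR R) -> \bar R})
  else cube_factor R n i.
have /choice[Q QP] n : exists Q : {measure set (seqspace R) -> \bar R},
    [/\ is_product_measure n (q n) Q,
        forall E, measurable E -> (Q E <= nu_ n E)%E &
        forall E, measurable E -> Q E = 0%E -> nu_ n E = 0%E].
  apply: (product_measure_densities _ _ (fun i => mu i) _ f (nu_P n) _ f01 _).
    by move=> i; exact: continuous_measurable_fun.
  by move=> i A ltin mA; rewrite /cube_factor ltin; exact: mu_density.
have prod_mu_strip n E : measurable E ->
    prod_mu (E `&` S n) = ((a n)%:E * Q n E)%E.
  have [Qm _ _] := QP n.
  apply: (product_measure_cube_strip n (fun i => mu i) (fun=> lebesgue01 R)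
    prod_mu (Q n) c) => //.
  - rewrite (_ : (fun i => _) = q n)//; apply/funext => i.
    by rewrite /q /cube_factor; case: ifP.
  - by move=> i; exact: probability_setT.
  - move=> i A mA.
    transitivity (\int[lebesgue_measure]_(x in A `&` `[0%R, 1%R]) (f i x)%:E)%E.
      by apply: mu_density; exact: measurableI.
    rewrite (eq_integral (cst (c i)%:E)).
      by rewrite integral_cst//; exact: measurableI.
    by move=> x; rewrite inE => -[_]/=; rewrite in_itv/= => /f_cube ->.
  - exact: cvg_prod_tail.
  - exact: ltW.
have prod_mu1 : prod_mu setT = 1%E by exact: product_measure_setT prod_muP _.
have Q1 n : Q n setT = 1%E.
  have [Qm _ _] := QP n; apply: product_measure_setT Qm _ => i ltin.
  by rewrite /q ltin; exact: probability_setT.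
have prod_mu_lim E : measurable E ->
    prod_mu (E `&` S n) @[n --> \oo] --> prod_mu E.
  apply: cvg_measure_setI_exhaustion => //.
    move=> i j ij; apply/subsetPset => x xS l jl.
    exact: xS (leq_trans ij jl).
  rewrite (_ : (fun n => _) = EFin \o a); first exact/cvg_EFin/a_cvg/nearW.
  by apply/funext => n; rewrite -[S n]setTI prod_mu_strip// Q1 mule1.
have a_le1 n : a n <= 1.
  have : (prod_mu (setT `&` S n) <= prod_mu setT)%E.
    by apply: le_measure; rewrite ?inE//; exact: measurableI.
  by rewrite prod_mu_strip// Q1 mule1 prod_mu1 lee_fin.
move=> E mE; have mES n : measurable (E `&` S n) by exact: measurableI.
split => [muE0|nuE0].
  have nuS0 n : nu_ n (E `&` S n) = 0%E.
    have [_ _ ->//] := QP n.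
    have : prod_mu (E `&` S n `&` S n) = 0%E.
      apply: (subset_measure0 _ mE _ muE0); last by move=> x [[]].
      exact: measurableI.
    rewrite prod_mu_strip// => /eqP; rewrite mule_eq0 eqe.
    by rewrite (gt_eqF (a_gt0 n)) => /eqP.
  apply: (cvg_unique _ (nu_lim E mE)) => //.
  by rewrite (_ : (fun n => _) = cst 0%E); [exact: cvg_cst|exact/funext].
suff : (prod_mu E <= nu_cube E)%E by rewrite nuE0 measure_le0 => /eqP.
rewrite -(cvg_lim _ (prod_mu_lim E mE))// -(cvg_lim _ (nu_lim E mE))//.
apply: lee_lim; [by apply: cvgP; exact: prod_mu_lim|
                 by apply: cvgP; exact: nu_lim|apply: nearW => n].
have [_ Qnu _] := QP n; apply: le_trans (Qnu _ (mES n)).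
have -> : E `&` S n = E `&` S n `&` S n by rewrite -setIA setIid.
rewrite prod_mu_strip// -setIA setIid -[leRHS]mul1e.
by rewrite lee_wpmul2r// lee_fin.
Qed.
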